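(* Let $f$ be a function satisfying property $P^{*}$, let $n\ge 1$ and $s\ge 0$ be integers, and let $\mathcal{G}_{n}^{s}$ be the set of all connected graphs of order $n$ with exactly $s$ cut edges. Then for any graph $G\in\mathcal{G}_{n}^{s}$, $$\rho_{f}(G)\le \rho_{f}\bigl(K_1\vee (K_{n-s-1}\cup sK_1)\bigr),$$ with equality if and only if $G\cong K_1\vee (K_{n-s-1}\cup sK_1)$.
   Context: All graphs are simple, finite and undirected. $K_m$ is the complete graph on $m$ vertices ($K_0$ is the graph with no vertices). $G_1\cup G_2$ is the disjoint union of graphs, $sK_1$ is the edgeless graph on $s$ vertices (no vertices if $s=0$), and the join $G_1\vee G_2$ is obtained from $G_1\cup G_2$ by adding all edges between vertices of $G_1$ and vertices of $G_2$. A cut edge of a connected graph is an edge whose deletion disconnects the graph. Weighted adjacency matrix: let $f(x,y)$ be a real-valued symmetric function ($f(x,y)=f(y,x)$) defined for real arguments $x,y\ge 1$. For a graph $G$ with vertices $v_1,\dots,v_n$ of degrees $d_1,\dots,d_n$, $A_f(G)$ is the $n\times n$ matrix whose $(i,j)$ entry is $f(d_i,d_j)$ if $v_i$ is adjacent to $v_j$, and $0$ otherwise. $\rho_f(G)$ denotes the spectral radius of $A_f(G)$ (the weighted spectral radius of $G$). Property $P^{*}$: the symmetric function $f$ satisfies property $P^{*}$ if (i) $f(x,y)>0$ and $f$ is increasing and convex in $x$, meaning $f_x(x,y)\ge 0$ and $f_{xx}(x,y)\ge 0$ (partial derivatives with respect to $x$, one-sided at the boundary of the domain); and (ii) whenever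 $x_1+y_1=x_2+y_2$ and $|x_1-y_1|>|x_2-y_2|$, one has $f(x_1,y_1)\ge f(x_2,y_2)$. *)

(* Defs.v *)
From HB Require Import structures.
From mathcomp Require Import all_boot all_order all_algebra.
From mathcomp Require Import complex.
From mathcomp Require Import all_classical all_reals all_analysis.

Set Implicit Arguments.
Unset Strict Implicit.
Unset Printing Implicit Defensive.

Import Order.TTheory GRing.Theory Num.Theory.
Import numFieldNormedType.Exports.

Local Open Scope classical_set_scope.
Local Open Scope ring_scope.

Record sgraph := SGraph {
  vertex :> finType;
  adj : rel vertex;
  adj_sym : symmetric adj;
  adj_irr : irreflexive adj }.

Definition iso (G H : sgraph) : Prop :=
  exists2 g : G -> H, bijective g & forall x y, adj (g x) (g y) = adj x y.

Section Constructions.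

Lemma complete_sym m : symmetric (fun x y : 'I_m => x != y).
Proof. by move=> x y; rewrite eq_sym. Qed.

Lemma complete_irr m : irreflexive (fun x y : 'I_m => x != y).
Proof. by move=> x; rewrite eqxx. Qed.

Definition complete (m : nat) : sgraph :=
  SGraph (@complete_sym m) (@complete_irr m).

Definition edgeless (s : nat) : sgraph :=
  @SGraph 'I_s (fun _ _ => false) (fun _ _ => erefl) (fun _ => erefl).

Variables G H : sgraph.

Definition union_rel (u v : G + H) : bool :=
  match u, v with
  | inl x, inl y => adj x y
  | inr x, inr y => adj x y
  | _, _ => false
  end.

Lemma union_sym : symmetric union_rel.
Proof. by move=> [x|x] [y|y] //=; rewrite adj_sym. Qed.

Lemma union_irr : irreflexive union_rel.
Proof. by move=> [x|x] /=; rewrite adj_irr. Qed.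

Definition gunion : sgraph := SGraph union_sym union_irr.

Definition join_rel (u v : G + H) : bool :=
  match u, v with
  | inl x, inl y => adj x y
  | inr x, inr y => adj x y
  | _, _ => true
  end.

Lemma join_sym : symmetric join_rel.
Proof. by move=> [x|x] [y|y] //=; rewrite adj_sym. Qed.

Lemma join_irr : irreflexive join_rel.
Proof. by move=> [x|x] /=; rewrite adj_irr. Qed.

Definition gjoin : sgraph := SGraph join_sym join_irr.

End Constructions.

Section Graph.
Variable G : sgraph.

Definition deg (x : G) : nat := #|[set y : G | adj x y]%SET|.

(* The graph with no vertices counts as connected. *)
Definition gconnected : bool := [forall x : G, forall y : G, connect (@adj G) x y].

(* Edges are the unordered pairs of adjacent vertices. *)
Definition edges : {set {set G}} :=
  [set E : {set G} | [exists x, exists y, adj x y && (E == [set x; y]%SET)]]%SET.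

End Graph.

Section Deletion.
Variables (G : sgraph) (E : {set G}).

Definition del_rel (x y : G) : bool := adj x y && ([set x; y]%SET != E).

Lemma del_sym : symmetric del_rel.
Proof. by move=> x y; rewrite /del_rel adj_sym finset.setUC. Qed.

Lemma del_irr : irreflexive del_rel.
Proof. by move=> x; rewrite /del_rel adj_irr. Qed.

Definition del_edge : sgraph := SGraph del_sym del_irr.

End Deletion.

Definition cut_edges (G : sgraph) : {set {set G}} :=
  [set E in edges G | ~~ gconnected (del_edge E)]%SET.

Definition graph_class (n s : nat) (G : sgraph) : Prop :=
  [/\ #|{: G}| = n, gconnected G & #|cut_edges G| = s].

Section Weighted.
Variable R : realType.

(* Maximum modulus of the complex eigenvalues; for a matrix of positive size
   the set below is finite and nonempty, so sup is its maximum. *)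
Definition spectral_radius (m : nat) (A : 'M[R]_m) : R :=
  sup [set r : R | exists2 z : R[i]%C,
         eigenvalue (map_mx (real_complex R) A) z & r = complex.Re `|z|].

Definition weighted_adj (f : R -> R -> R) (G : sgraph) : 'M[R]_#|{: G}| :=
  \matrix_(i, j) (if adj (enum_val i) (enum_val j)
                  then f (deg (enum_val i))%:R (deg (enum_val j))%:R else 0).

Definition rho (f : R -> R -> R) (G : sgraph) : R :=
  spectral_radius (weighted_adj f G).

(* g has derivative l at x relative to [1, +oo[: a two-sided derivative for
   1 < x, the right derivative for x = 1. *)
Definition has_derive_ge1 (g : R -> R) (x l : R) : Prop :=
  h^-1 * (g (x + h) - g x) @[h --> within [set h | 1 <= x + h] 0^'] --> l.

(* f represents a function on [1, +oo[ x [1, +oo[: its values elsewhere are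
   unconstrained. *)
Definition symmetric_ge1 (f : R -> R -> R) : Prop :=
  forall x y, 1 <= x -> 1 <= y -> f x y = f y x.

Record property_Pstar (f : R -> R -> R) : Prop := PropertyPstar {
  Pstar_pos : forall x y, 1 <= x -> 1 <= y -> 0 < f x y;
  Pstar_incr_convex : exists fx fxx : R -> R -> R,
    forall x y, 1 <= x -> 1 <= y ->
      [/\ has_derive_ge1 (f ^~ y) x (fx x y),
          has_derive_ge1 (fx ^~ y) x (fxx x y),
          0 <= fx x y & 0 <= fxx x y];
  Pstar_spread : forall x1 y1 x2 y2,
    1 <= x1 -> 1 <= y1 -> 1 <= x2 -> 1 <= y2 ->
    x1 + y1 = x2 + y2 -> `|x1 - y1| > `|x2 - y2| -> f x1 y1 >= f x2 y2 }.

End Weighted.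

(* For n <= s the subtraction truncates, but then [graph_class n s] is empty:
   a connected graph of order n has at most n - 1 cut edges. *)
Definition extremal_graph (n s : nat) : sgraph :=
  gjoin (complete 1) (gunion (complete (n - s - 1)) (edgeless s)).

(* Main.v *)
(* Enlarge the class to the connected graphs of order n with at least s cut
   edges, and let M maximise the weighted spectral radius in it. For an edge uv
   with x_u >= x_v, x the Perron vector of M, the Kelmans operation moving the
   private neighbours of v to u keeps M connected and loses no cut edge; it
   strictly increases rho_f as soon as u and v both have private neighbours.
   Hence adjacent vertices of M have nested closed neighbourhoods, so a vertex
   c of maximum degree is adjacent to all others, every cut edge joins c to a
   leaf, and there are at least s leaves. Fix s of them: joining two other
   non-adjacent vertices keeps their s cut edges and increases rho_f, so the
   other vertices form a clique and M is the extremal graph. *)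
Require Import Defs.
From mathcomp Require Import all_boot all_order all_algebra.
From mathcomp Require Import zify.

Set Implicit Arguments.
Unset Strict Implicit.
Unset Printing Implicit Defensive.

(** * Cut edges and the Kelmans operation *)

Section Cuts.
Variable G : sgraph.

(** A certificate that [E] is a cut edge: [E] is the only edge between [S] and its complement.
    Unlike non-connectedness, it is easy to carry through a graph operation. *)
Definition separates (S : G -> bool) (E : {set G}) : Prop :=
  (exists a b, [/\ adj a b, S a != S b & E = [set a; b]]) /\
  forall x y, adj x y -> S x != S y -> [set x; y] = E.

Lemma separates_cut S E : separates S E -> E \in cut_edges G.
Proof.
move=> [[a [b [ab Sab EE]]] SE]; rewrite !inE; apply/andP; split.
  by apply/existsP; exists a; apply/existsP; exists b; rewrite ab EE eqxx.
apply/negP => /forallP/(_ a)/forallP/(_ b) conn.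
have S_closed : closed (@adj (del_edge E)) [pred x | S x].
  move=> x y /andP[xy nE]; rewrite !inE; apply/eqP; apply: contraNT nE => Sxy.
  by rewrite (SE x y).
by have := closed_connect S_closed conn; rewrite !inE => e;
  rewrite e eqxx in Sab.
Qed.

Lemma exists_crossing_edge (S : G -> bool) x y :
  gconnected G -> S x != S y -> exists a b, adj a b /\ S a != S b.
Proof.
move=> /forallP/(_ x)/forallP/(_ y) conn Sxy.
have [|noS] := boolP [exists a, exists b, adj a b && (S a != S b)].
  by case/existsP => a /existsP[b /andP[]]; exists a, b.
have S_closed : closed (@adj G) [pred x | S x].
  move=> a b ab; rewrite !inE; apply/eqP; apply: contraNT noS => Sab.
  by apply/existsP; exists a; apply/existsP; exists b; rewrite ab.
by have := closed_connect S_closed conn; rewrite !inE => e;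
  rewrite e eqxx in Sxy.
Qed.

(** [S] is the component, after deletion of [E], of one of two vertices that the deletion separates.
    Only [E] can leave it, and some edge does because [G] is connected. *)
Lemma cut_separates E : gconnected G -> E \in cut_edges G ->
  exists S, separates S E.
Proof.
move=> conn; rewrite !inE => /andP[_ /forallPn[x /forallPn[y nxy]]].
pose S (z : G) : bool := connect (@adj (del_edge E)) x z; exists S.
have SE (a b : G) : adj a b -> S a != S b -> [set a; b] = E.
  move=> ab; apply: contra_neq_eq => nE; rewrite /S.
  have dab : @adj (del_edge E) a b by apply/andP.
  have csym : connect_sym (@adj (del_edge E)).
    exact: (sym_connect_sym (@adj_sym (del_edge E))).
  exact: (same_connect_r csym (connect1 dab)).
split=> //; have [|a [b [ab Sab]]] := @exists_crossing_edge S x y conn.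
  by rewrite /S connect0 (negbTE nxy).
by exists a, b; rewrite (SE a b).
Qed.

Lemma cut_edge_adj a b : [set a; b] \in cut_edges G -> adj a b.
Proof.
rewrite inE => /andP[];
  rewrite inE => /existsP[x /existsP[y /andP[xy /eqP e]]] _.
have xP : x \in [set a; b] by rewrite e set21.
have yP : y \in [set a; b] by rewrite e set22.
rewrite !inE in xP yP; case/orP: xP yP xy => /eqP-> /orP[]/eqP-> //.
- by rewrite adj_irr.
- by rewrite adj_sym.
- by rewrite adj_irr.
Qed.

(** For a partition with [ab] as its only crossing edge, neither [ac] nor [bc] crosses, so [a] and
    [b] lie on the same side. *)
Lemma triangle_not_cut a b c : gconnected G ->
  adj a c -> adj b c -> [set a; b] \notin cut_edges G.
Proof.
move=> conn ac bc; apply/negP => E_cut; have ab := cut_edge_adj E_cut.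
have [S [[x [y [xy Sxy Exy]]] SE]] := cut_separates conn E_cut.
have Sac : S a = S c.
  apply/eqP; apply: contraT => /(SE _ _ ac) /setP/(_ c).
  by rewrite !inE eqxx orbT => /esym/orP[]/eqP e; rewrite e adj_irr in ac bc.
have Sbc : S b = S c.
  apply/eqP; apply: contraT => /(SE _ _ bc) /setP/(_ c).
  by rewrite !inE eqxx orbT => /esym/orP[]/eqP e; rewrite e adj_irr in ac bc.
have : x \in [set a; b] by rewrite Exy set21.
have : y \in [set a; b] by rewrite Exy set22.
by rewrite !inE => /orP[]/eqP ey /orP[]/eqP ex;
  rewrite ex ey ?Sac ?Sbc eqxx in Sxy.
Qed.

End Cuts.

(** * The Kelmans operation: degrees, connectedness and cut edges *)

Section Kelmans.
Variables (G : sgraph) (u v : G).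

Definition private (w : G) : bool := [&& adj v w, ~~ adj u w & w != u].

(** The relation lives on the vertices of [G], so that one vector can be tested against both
    graphs. *)
Definition kelmans_rel (x y : G) : bool :=
  [|| adj x y && ~~ ((x == v) && private y || (y == v) && private x),
      (x == u) && private y | (y == u) && private x].

Lemma kelmans_sym : symmetric kelmans_rel.
Proof.
move=> x y; rewrite /kelmans_rel adj_sym.
by rewrite [X in ~~ X]orbC [X in _ || X]orbC.
Qed.

Lemma in_private w : (w \in private) = private w.
Proof. by []. Qed.

Lemma privateu : private u = false.
Proof. by rewrite /private eqxx !andbF. Qed.

Lemma privatev : private v = false.
Proof. by rewrite /private adj_irr. Qed.

Lemma kelmans_irr : irreflexive kelmans_rel.
Proof.
move=> x; rewrite /kelmans_rel adj_irr /= orbb; apply/negP => /andP[/eqP->].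
by rewrite privateu.
Qed.

Definition kelmans : sgraph := SGraph kelmans_sym kelmans_irr.

Hypothesis uv : adj u v.

Lemma kelmans_neq : u != v.
Proof. by apply: contraTneq uv => ->; rewrite adj_irr. Qed.

Lemma kelmans_adju w : kelmans_rel u w = adj u w || private w.
Proof.
rewrite /kelmans_rel eqxx (negbTE kelmans_neq) privateu !andbF /= andbT.
by rewrite orbF.
Qed.

Lemma kelmans_adjv w : kelmans_rel v w = adj v w && ~~ private w.
Proof.
rewrite /kelmans_rel eqxx [v == u]eq_sym (negbTE kelmans_neq) privatev !andbF
  /=.
by rewrite !orbF.
Qed.

Lemma kelmans_adj x y : x != u -> x != v -> y != u -> y != v ->
  kelmans_rel x y = adj x y.
Proof.
move=> xu xv yu yv; rewrite /kelmans_rel (negbTE xu) (negbTE xv).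
by rewrite (negbTE yu) (negbTE yv) /= andbT !orbF.
Qed.

Lemma kelmans_deg_u : @deg kelmans u = deg u + #|private|.
Proof.
rewrite /deg -[X in _ + X]cardsE -cardsUI.
have -> : [set y | adj u y] :&: [set y in private] = set0.
  apply/setP => w; rewrite !inE in_private /private.
  by case: (adj u w); rewrite ?andbF.
rewrite cards0 addn0; apply: eq_card => w.
by rewrite !inE /= kelmans_adju.
Qed.

Lemma kelmans_deg_v : @deg kelmans v + #|private| = deg v.
Proof.
rewrite /deg -[X in _ + X]cardsE -cardsUI.
have -> : [set y | @adj kelmans v y] :&: [set y in private] = set0.
  apply/setP => w; rewrite !inE /= kelmans_adjv in_private.
  by case: (private w); rewrite ?andbF.
rewrite cards0 addn0; apply: eq_card => w.
rewrite !inE /= kelmans_adjv in_private.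
by have [/and3P[-> _ _]|] := boolP (private w); rewrite /= ?orbF ?andbT.
Qed.

(** A private neighbour of [v] exchanges [v] for [u]; every other such vertex keeps its
    neighbours. *)
Lemma kelmans_deg w : w != u -> w != v -> @deg kelmans w = deg w.
Proof.
move=> wu wv; rewrite /deg.
have [w_priv|w_nonpriv] := boolP (private w); last first.
  apply: eq_card => y; rewrite !inE /= /kelmans_rel (negbTE wu) (negbTE wv).
  by rewrite (negbTE w_nonpriv) !andbF /= andbT orbF.
have [vw nuw _] := and3P w_priv.
have -> : [set y | @adj kelmans w y] = u |: [set y | adj w y] :\ v.
  apply/setP => y; rewrite !inE /=.
  have [->|yu] := eqVneq y u;
    first by rewrite kelmans_sym kelmans_adju w_priv orbT.
  have [->|yv] := eqVneq y v;
    first by rewrite kelmans_sym kelmans_adjv w_priv andbF.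
  by rewrite kelmans_adj.
rewrite cardsU1 !inE kelmans_neq adj_sym (negbTE nuw) /=.
by rewrite [RHS](cardsD1 v) inE adj_sym vw.
Qed.

(** The neighbours that [v] keeps, apart from [u], are neighbours of [u] other than [v], and [w] is
    not among them. The spread and convexity arguments of [rho_kelmans] rest on this comparison. *)
Lemma kelmans_deg_lt w : adj u w -> ~~ adj v w -> w != v ->
  @deg kelmans v < deg u.
Proof.
move=> uw nvw wv; rewrite [X in _ < X](cardsD1 v) inE uv add1n ltnS.
rewrite /deg [X in X <= _](cardsD1 u) !inE /= kelmans_adjv adj_sym uv privateu
  /= add1n.
apply: proper_card; apply/properP; split.
  apply/subsetP => y; rewrite !inE /= kelmans_adjv => /and3P[yu vy].
  rewrite /private vy yu andbT /= negbK => ->; rewrite andbT.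
  by apply: contraTneq vy => ->; rewrite adj_irr.
by exists w; rewrite !inE /= ?uw ?wv // kelmans_adjv (negbTE nvw) andbF.
Qed.

(** A lost edge [vw] is replaced by the path [v], [u], [w]. *)
Lemma kelmans_connected : gconnected G -> gconnected kelmans.
Proof.
move=> /forallP conn; apply/forallP => x; apply/forallP => y.
apply: (connect_sub _ (forallP (conn x) y)) => {x y} x y xy.
have vuw w : private w -> connect kelmans_rel v w.
  move=> w_priv; apply: (@connect_trans _ _ u); apply: connect1.
    by rewrite kelmans_adjv adj_sym uv privateu.
  by rewrite kelmans_adju w_priv orbT.
have [kxy|] := boolP (kelmans_rel x y); first exact: connect1.
rewrite /kelmans_rel xy /= negb_or negbK => /andP[].
case/orP => /andP[/eqP-> w_priv] _; first exact: vuw.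
by rewrite (sym_connect_sym kelmans_sym); apply: vuw.
Qed.

(** The test does not mention [private]: if [vw] is a cut edge of a connected graph and [w] is not
    [u], then [w] is private, as otherwise [uvw] would be a triangle. *)
Definition move_edge (E : {set G}) : {set G} :=
  if (v \in E) && (u \notin E) then u |: E :\ v else E.

(** If [S] separates [u] from [v], then [E] is [uv] and [v] becomes a leaf, so [v] alone is the new
    side. Otherwise [S] itself serves: a new edge [uw] crosses it exactly when [vw] did. *)
Lemma separates_kelmans S E : @separates G S E ->
  exists S', @separates kelmans S' (move_edge E).
Proof.
move=> [[a [b [ab Sab EE]]] SE].
have [Suv|Suv] := eqVneq (S u) (S v); last first.
  have Euv := SE _ _ uv Suv.
  have -> : move_edge E = [set u; v].
    by rewrite /move_edge -Euv !inE !eqxx /= andbF.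
  exists (fun w => w == v); split.
    by exists u, v; split;
      rewrite /= ?kelmans_adju ?uv // eqxx (negbTE kelmans_neq).
  (* A neighbour [x] kept by [v] and other than [u] would be adjacent to both; neither [ux] nor [vx]
     is [E], so [u] and [v] would lie on one side. *)
  have vx x : kelmans_rel v x -> x = u.
    rewrite kelmans_adjv => /andP[vx]; rewrite /private vx /=.
    have [//|xu] := eqVneq x u; rewrite andbT negbK => ux.
    have xE : x \notin E by rewrite -Euv !inE (negbTE xu) /=;
      apply: contraTneq vx => ->; rewrite adj_irr.
    have Sux : S u = S x.
      by apply/eqP; apply: contraNT xE => /(SE _ _ ux) <-; rewrite set22.
    have Svx : S v = S x.
      by apply/eqP; apply: contraNT xE => /(SE _ _ vx) <-; rewrite set22.
    by rewrite Sux Svx eqxx in Suv.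
  move=> x y /= kxy.
  have [xv|xv] := eqVneq x v.
    by move: kxy; rewrite xv => /vx -> _; rewrite setUC.
  have [yv _|//] := eqVneq y v.
  by move: kxy; rewrite yv kelmans_sym => /vx ->.
have SE_priv w : private w -> S u != S w -> [set u; w] = move_edge E.
  case/and3P=> vw _ wu; rewrite Suv => /(SE _ _ vw) <-.
  have wv : w != v by apply: contraTneq vw => ->; rewrite adj_irr.
  rewrite /move_edge !inE eqxx (negbTE kelmans_neq) [u == w]eq_sym (negbTE wu)
    /=.
  apply/setP => z; rewrite !inE; have [->|zv] := eqVneq z v.
    by rewrite [v == u]eq_sym (negbTE kelmans_neq) [v == w]eq_sym (negbTE wv).
  by [].
(* If a common neighbour [w] were opposite [v], hence opposite [u], both [vw] and [uw] would be the
   single crossing edge. *)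
have uE w : adj v w -> w != u -> ~~ private w -> S v = S w.
  move=> vw wu; rewrite /private vw wu andbT /= negbK => uw.
  apply/eqP; apply: contraT => Svw; have := SE _ _ vw Svw.
  rewrite -Suv in Svw; rewrite -(SE _ _ uw Svw) => /setP/(_ u).
  by rewrite !inE eqxx (negbTE kelmans_neq) [u == w]eq_sym (negbTE wu).
(* Were a surviving crossing edge at [v] and away from [u], its other end would not be private,
   hence on the side of [v] by [uE]. *)
have move_id x y : adj x y -> S x != S y ->
    ~~ ((x == v) && private y || (y == v) && private x) ->
    move_edge E = E.
  move=> xy Sxy; rewrite negb_or => /andP[nxv nyv].
  rewrite /move_edge -(SE _ _ xy Sxy) !inE; case: ifP => // /andP[].
  case/orP => /eqP e; rewrite e negb_or => /andP[ux uy].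
    rewrite -e eqxx /= in nxv.
    by rewrite -e (uE y) ?eqxx ?(eq_sym y) // e in Sxy.
  rewrite -e eqxx /= in nyv.
  by rewrite -e eq_sym (uE x) ?eqxx ?(eq_sym x) // e adj_sym in Sxy.
exists S; split; last first.
  move=> x y /= /or3P[/andP[xy nmv]|/andP[/eqP-> y_priv]|/andP[/eqP-> x_priv]]
    Sxy.
  - by rewrite (move_id x y) // SE.
  - exact: SE_priv.
  - by rewrite setUC; apply: SE_priv; rewrite // eq_sym.
have moved w : adj v w -> S v != S w -> private w ->
    exists a b, [/\ @adj kelmans a b, S a != S b & move_edge E = [set a; b]].
  move=> vw Svw w_priv; exists u, w; rewrite /= kelmans_adju w_priv orbT Suv.
  by split=> //; rewrite SE_priv // Suv.
have [|nmv] := boolP ((a == v) && private b || (b == v) && private a).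
  case/orP => /andP[/eqP e]; first by rewrite e in ab Sab; apply: moved.
  by rewrite e eq_sym in Sab; rewrite e adj_sym in ab; apply: moved.
exists a, b; split=> //; first by rewrite /= /kelmans_rel ab nmv.
by rewrite (move_id a b).
Qed.

(* A cut edge vw lies in no triangle, so its image uw is not an edge of G. *)
Lemma move_edge_inj : gconnected G -> {in cut_edges G &, injective move_edge}.
Proof.
move=> conn.
have aux E1 E2 : E1 \in cut_edges G -> E2 \in cut_edges G ->
    (v \in E1) && (u \notin E1) -> ~~ ((v \in E2) && (u \notin E2)) ->
    u |: E1 :\ v <> E2.
  move=> E1_cut E2_cut /andP[vE1 uE1] _ e.
  have [w E1w] : exists w, E1 = [set v; w].
    move: E1_cut vE1; rewrite inE => /andP[+ _]; rewrite inE.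
    case/existsP => x /existsP[y /andP[_ /eqP->]]; rewrite !inE.
    by case/orP => /eqP->; [exists y | exists x; rewrite setUC].
  have vw : adj v w by apply: cut_edge_adj; rewrite -E1w.
  have uw : adj u w.
    apply: cut_edge_adj; suff -> : [set u; w] = E2 by [].
    have wv : w != v by apply: contraTneq vw => ->; rewrite adj_irr.
    rewrite -e E1w; apply/setP => z; rewrite !inE; have [->|//] := eqVneq z v.
    by rewrite [v == u]eq_sym (negbTE kelmans_neq) [v == w]eq_sym (negbTE wv).
  have := triangle_not_cut (a := v) (b := w) (c := u) conn.
  by rewrite -E1w E1_cut adj_sym uv adj_sym uw => /(_ isT isT).
move=> E1 E2 E1_cut E2_cut; rewrite /move_edge.
case: ifPn => m1; case: ifPn => m2 //.
- case/andP: m1 m2 => v1 u1 /andP[v2 u2] e.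
  apply/setP => z; have [->|zv] := eqVneq z v; first by rewrite v1 v2.
  have [->|zu] := eqVneq z u; first by rewrite (negbTE u1) (negbTE u2).
  by move/setP/(_ z): e; rewrite !inE zv (negbTE zu).
- by move=> e; case: (aux E1 E2).
- by move=> e; case: (aux E2 E1).
Qed.

Lemma kelmans_cut_edges : gconnected G -> #|cut_edges G| <= #|cut_edges
  kelmans|.
Proof.
move=> conn; rewrite -(card_in_imset (move_edge_inj conn)).
apply: subset_leq_card; apply/subsetP => _ /imsetP[E E_cut ->].
have [S SE] := cut_separates conn E_cut; have [S' S'E] := separates_kelmans SE.
exact: separates_cut S'E.
Qed.

End Kelmans.

(** * Adding an edge *)

Section AddEdge.
Variables (G : sgraph) (x y : G).
Hypothesis xy : x != y.

Definition add_rel (a b : G) : bool :=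
  [|| adj a b, (a == x) && (b == y) | (a == y) && (b == x)].

Lemma add_sym : symmetric add_rel.
Proof.
by move=> a b; rewrite /add_rel adj_sym [X in _ || X]orbC ![(a == _) && _]andbC.
Qed.

Lemma add_irr : irreflexive add_rel.
Proof.
move=> a; rewrite /add_rel adj_irr /= [(a == y) && _]andbC orbb.
by have [->|//] := eqVneq a x; rewrite (negbTE xy).
Qed.

Definition add_edge : sgraph := SGraph add_sym add_irr.

Lemma add_edge_connected : gconnected G -> gconnected add_edge.
Proof.
move=> /forallP conn; apply/forallP => a; apply/forallP => b.
apply: connect_sub (forallP (conn a) b) => {}a {}b ab.
by apply: connect1; rewrite /= /add_rel ab.
Qed.

End AddEdge.

(** Take [c] of maximum degree. If [c] misses a vertex, some edge [ab] leaves its closed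
    neighbourhood. As [b] is adjacent to [a] but not to [c], nestedness puts the closed
    neighbourhood of [c] inside that of [a], which also contains [b]: the degree of [a] is too
    large. *)
Lemma exists_universal_vertex (G : sgraph) : 0 < #|{: G}| -> gconnected G ->
    (forall u v : G, adj u v ->
       (forall w, adj v w -> w != u -> adj u w) \/
       (forall w, adj u w -> w != v -> adj v w)) ->
  exists c : G, forall w, w != c -> adj c w.
Proof.
case/card_gt0P => x0 _ conn nested.
case: (@arg_maxnP _ x0 xpredT (@deg G) isT) => c _ c_max.
exists c => w0 w0c; apply/negPn/negP => cw0.
pose S z := (z == c) || adj c z.
have Sc : S c != S w0 by rewrite /S eqxx (negbTE w0c) (negbTE cw0).
have [a [b [ab Sab]]] := exists_crossing_edge conn Sc.
wlog {Sab} [Sa nSb] : a b ab / S a /\ ~~ S b.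
  move=> H; case: (boolP (S a)) Sab => Sa; case: (boolP (S b)) => Sb // _.
    exact: (H a b).
  by apply: (H b a); rewrite ?Sa // adj_sym.
have [bc cb] : b != c /\ ~~ adj c b by apply/andP; rewrite -negb_or.
have ca : adj c a.
  by case/orP: Sa => // /eqP e; rewrite -e ab in cb.
have [ac_sub|ca_sub] := nested c a ca.
  by rewrite (ac_sub b) in cb.
suff : deg c < deg a by rewrite ltnNge; apply/negP/negPn; apply: c_max.
have b_notin : b \notin c |: [set z | adj c z] :\ a.
  by rewrite !inE negb_or bc (negbTE cb) andbF.
have c_notin : c \notin [set z | adj c z] :\ a by rewrite !inE adj_irr andbF.
have : b |: (c |: [set z | adj c z] :\ a) \subset [set z | adj a z].
  apply/subsetP => z; rewrite !inE => /or3P[/eqP->//|/eqP->|/andP[za cz]].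
    by rewrite adj_sym.
  exact: ca_sub.
move/subset_leq_card; rewrite cardsU1 b_notin cardsU1 c_notin.
by rewrite [X in X < _](cardsD1 a) inE ca.
Qed.

(** * Graphs with a universal vertex: leaves and the extremal shape *)

Section Universal.
Variables (G : sgraph) (c : G).
Hypothesis c_univ : forall w, w != c -> adj c w.

Definition leaves : {set G} :=
  [set l | (l != c) && [forall w, adj l w ==> (w == c)]].

Lemma leavesP l : reflect (l != c /\ forall w, adj l w -> w = c) (l \in leaves).
Proof.
rewrite inE; apply: (iffP andP) => -[lc lw]; split=> //.
  by move=> w /(implyP (forallP lw w))/eqP.
by apply/forallP => w; apply/implyP => /lw ->.
Qed.

Lemma pair_inj (a b : G) : a != c -> [set c; a] = [set c; b] -> a = b.
Proof.
move=> ac /setP/(_ a); rewrite !inE eqxx orbT (negbTE ac) /=.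
by move/esym/eqP.
Qed.

(** A cut edge that avoids [c] would form a triangle with [c], and so would a cut edge [cl] with a
    further neighbour of [l]. Hence every cut edge joins [c] to a leaf. *)
Lemma cut_edges_leaves : gconnected G -> #|cut_edges G| <= #|leaves|.
Proof.
move=> conn; apply: leq_trans (leq_imset_card (fun l => [set c; l]) leaves).
apply: subset_leq_card; apply/subsetP => E E_cut.
have [a [b [ab EE]]] : exists a b, adj a b /\ E = [set a; b].
  move: E_cut; rewrite inE => /andP[+ _]; rewrite inE.
  by case/existsP => a /existsP[b /andP[ab /eqP->]]; exists a, b.
have [l [lc El]] : exists l, l != c /\ E = [set c; l].
  have [ac|ac] := eqVneq a c.
    exists b; rewrite -ac; split=> //.
    by apply: contraTneq ab => ->; rewrite adj_irr.
  have [bc|bc] := eqVneq b c; first by exists a; rewrite -bc setUC EE;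
    split; rewrite // bc.
  have := triangle_not_cut (a := a) (b := b) (c := c) conn.
  by rewrite -EE E_cut adj_sym c_univ // adj_sym c_univ // => /(_ isT isT).
apply/imsetP; exists l => //; apply/leavesP; split=> // w lw.
apply/eqP; apply: contraTT E_cut => wc; rewrite El setUC.
apply: (triangle_not_cut (c := w)) => //; last exact: c_univ.
Qed.

(** A leaf in [T] is not an end of the new edge, so it stays a leaf, and the partition with it alone
    on one side certifies its edge to [c]. *)
Lemma add_edge_cut (T : {set G}) (x y : G) (xy : x != y) :
    T \subset leaves -> x \notin T -> y \notin T ->
  #|T| <= #|cut_edges (add_edge xy)|.
Proof.
move=> /subsetP TL xT yT; rewrite -(card_in_imset (f := fun l => [set c; l])).
  apply: subset_leq_card; apply/subsetP => _ /imsetP[l lT ->].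
  have [lc l_leaf] := leavesP _ (TL _ lT).
  have lx : l != x by apply: contraNneq xT => <-.
  have ly : l != y by apply: contraNneq yT => <-.
  have ladj w : add_rel x y l w -> w = c.
    by rewrite /add_rel (negbTE lx) (negbTE ly) orbF => /l_leaf.
  apply: (@separates_cut (add_edge xy) (fun w => w == l)); split.
    exists c, l; rewrite eqxx [c == l]eq_sym (negbTE lc); split=> //.
    by apply/or3P; constructor 1; apply: c_univ.
  move=> a b /=; have [->|al] := eqVneq a l.
    by move/ladj => -> _; rewrite setUC.
  by have [->|//] := eqVneq b l; rewrite add_sym => /ladj ->.
move=> a b aT bT; apply: pair_inj.
by have [] := leavesP _ (TL _ aT).
Qed.

Lemma iso_extremal (T : {set G}) : T \subset leaves ->
    (forall x y, x \notin c |: T -> y \notin c |: T -> x != y -> adj x y) ->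
  iso G (extremal_graph #|{: G}| #|T|).
Proof.
move=> /subsetP TL clique; pose K := ~: (c |: T).
have cT : c \notin T.
  by apply/negP => /TL/leavesP[]; rewrite eqxx.
have cardK : #|{: G}| - #|T| - 1 = #|K|.
  by rewrite -(cardsC (c |: T)) cardsU1 cT -/K; lia.
have cardG : #|{: G}| = 1 + (#|K| + #|T|).
  by rewrite -(cardsC (c |: T)) cardsU1 cT -/K; lia.
pose H := extremal_graph #|{: G}| #|T|.
(* The isomorphism is built from the extremal graph, whose vertices allow case analysis, and
   inverted at the end. *)
pose h (z : H) : G := match z with
  | inl _ => c
  | inr (inl i) => enum_val (cast_ord cardK i)
  | inr (inr j) => enum_val j
  end.
have hK i : enum_val (cast_ord cardK i) \in K by apply: enum_valP.
have hT (j : 'I_#|T|) : enum_val j \in T by apply: enum_valP.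
have Kc i : enum_val (cast_ord cardK i) != c.
  by have := hK i; rewrite !inE negb_or => /andP[].
have Tc (j : 'I_#|T|) : enum_val j != c by apply: contraNneq cT => <-.
have KT i (j : 'I_#|T|) : enum_val (cast_ord cardK i) != enum_val j.
  have := hK i; rewrite !inE negb_or => /andP[_]; apply: contraNneq => ->.
  exact: hT.
have h_inj : injective h.
  move=> [i|[i|i]] [j|[j|j]] //= e.
  - by rewrite !ord1.
  - by have := Kc j; rewrite -e eqxx.
  - by have := Tc j; rewrite -e eqxx.
  - by have := Kc i; rewrite e eqxx.
  - by move/enum_val_inj/cast_ord_inj: e => ->.
  - by have := KT i j; rewrite e eqxx.
  - by have := Tc i; rewrite e eqxx.
  - by have := KT j i; rewrite e eqxx.
  - by move/enum_val_inj: e => ->.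
have h_adj a b : adj (h a) (h b) = adj a b.
  have Tadj (j : 'I_#|T|) w : w != c -> adj (enum_val j) w = false.
    by move=> wc; apply: contra_neqF wc;
      case/leavesP: (TL _ (hT j)) => _; apply.
  case: a b => [i|[i|i]] [j|[j|j]] //=.
  - by rewrite adj_irr !ord1 eqxx.
  - exact: c_univ.
  - exact: c_univ.
  - by rewrite adj_sym; apply: c_univ.
  - have [->|ij] := eqVneq i j; first by rewrite adj_irr.
    apply: clique; rewrite -?in_setC ?hK //.
    by apply: contra_neq ij => /enum_val_inj/cast_ord_inj.
  - by rewrite adj_sym Tadj.
  - by rewrite adj_sym; apply: c_univ.
  - by rewrite Tadj.
  - by rewrite Tadj.
have [g hg gh] : bijective h.
  apply: inj_card_bij => //; rewrite cardG !card_sum !card_ord cardK; lia.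
exists g; first by exists h.
by move=> a b; rewrite -h_adj !gh.
Qed.

End Universal.

From mathcomp Require Import sesquilinear spectral complex.
From mathcomp Require Import all_classical all_reals all_analysis.
From mathcomp Require Import ring lra.

Import Order.TTheory GRing.Theory Num.Theory.
Import numFieldNormedType.Exports.

Local Open Scope ring_scope.

(** * Spectral radius of symmetric real matrices *)

Section SymmetricMatrix.
Local Open Scope sesquilinear_scope.
Local Open Scope complex_scope.
Variables (R : realType) (m : nat) (A : 'M[R]_m).
Hypothesis A_sym : A^T = A.

Local Notation toC := (map_mx (real_complex R)).

Lemma trmxC_real p q (B : 'M[R]_(p, q)) : (toC B)^t* = toC B^T.
Proof.
apply/matrixP => i j; rewrite !mxE; apply/CrealP.
by rewrite complex_real.
Qed.

(** Over the complex numbers [A] is Hermitian, hence unitarily diagonalisable with real eigenvalues,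
    kept in a real row [d]. *)
Lemma symmetric_spectral : exists P : 'M[R[i]]_m, exists d : 'rV[R]_m,
  P \is unitarymx /\ toC A = P^t* *m diag_mx (toC d) *m P.
Proof.
have hA : toC A \is hermsymmx.
  by apply/is_hermitianmxP; rewrite expr0 scale1r trmxC_real A_sym.
have := orthomx_spectralP (hermitian_normalmx hA).
have := hermitian_spectral_diag_real hA; have := spectral_unitarymx (toC A).
move: (spectralmx _) (spectral_diag _) => P d uP /mxOverP d_real eA.
exists P, (map_mx (@complex.Re R) d); split; first exact: uP.
have -> : toC (map_mx (@complex.Re R) d) = d.
  by apply/matrixP => i j; rewrite !mxE RRe_real.
by rewrite -(invmx_unitary uP).
Qed.

(** In eigenvector coordinates the form is diagonal. With [r] the spectral radius all coefficients
    are nonnegative, which yields both the Rayleigh bound and its equality case. *)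
Lemma spectral_quadratic (P : 'M[R[i]]_m) (d : 'rV[R]_m) (x : 'rV[R]_m) :
    P \is unitarymx -> toC A = P^t* *m diag_mx (toC d) *m P -> forall r : R,
  ((r *: (x *m x^T) - x *m A *m x^T) 0 0)%:C
  = \sum_i (r - d 0 i)%:C * `|(toC x *m P^t*) 0 i| ^+ 2.
Proof.
move=> uP eA r; set y := toC x *m P^t*.
have ey : toC x^T = P^t* *m y^t*.
  rewrite -trmxC_real trmx_mul map_mxM trmxCK mulmxA.
  by rewrite -invmx_unitary // mulVmx ?unitarymx_unit // mul1mx.
have -> : ((r *: (x *m x^T) - x *m A *m x^T) 0 0)%:C
   = toC (r *: (x *m x^T) - x *m A *m x^T) 0 0 by rewrite !mxE.
have -> : toC (r *: (x *m x^T) - x *m A *m x^T)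
   = r%:C *: (y *m y^t*) - y *m diag_mx (toC d) *m y^t*.
  rewrite map_mxB map_mxZ !map_mxM /= ey eA /y !mulmxA; congr (_ - _).
  by rewrite mulmxtVK.
rewrite mul_mx_diag !mxE mulr_sumr -sumrB; apply: eq_bigr => i _.
by rewrite !mxE normCK rmorphB /=; ring.
Qed.

Lemma eigenvalue_spectral (P : 'M[R[i]]_m) (d : 'rV[R]_m) (z : R[i]) :
    P \is unitarymx -> toC A = P^t* *m diag_mx (toC d) *m P ->
  eigenvalue (toC A) z <-> exists i, z = (d 0 i)%:C.
Proof.
move=> uP eA; split.
  case/eigenvalueP=> v vA v0; set y := v *m P^t*.
  have y0 : y != 0.
    apply: contra_neq v0 => y0.
    by rewrite -[v](mulmxKtV v uP) // -/y y0 mul0mx.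
  have [i yi] : exists i, y 0 i != 0.
    apply/existsP; apply: contraNT y0; rewrite negb_exists => /forallP y0.
    by apply/eqP/rowP => i; have /negbNE/eqP -> := y0 i; rewrite mxE.
  have yd : y *m diag_mx (toC d) = z *: y.
    by rewrite /y scalemxAl -vA eA !mulmxA mulmxtVK.
  exists i; clearbody y; move/rowP/(_ i): yd.
  by rewrite mul_mx_diag !mxE [y 0 i * _]mulrC => /(mulIf yi).
case=> i ->; apply/eigenvalueP; exists (row i P).
  rewrite eA !mulmxA -row_mul (unitarymxP uP) row1 -rowE row_diag_mx.
  by rewrite -scalemxAl -rowE !mxE.
apply/eqP => /(congr1 (mulmx^~ (P^t*))).
rewrite -row_mul (unitarymxP uP) mul0mx => /rowP/(_ i).
by rewrite !mxE eqxx /= => /eqP; rewrite oner_eq0.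
Qed.

Hypothesis m_gt0 : (0 < m)%N.

(** The set in the definition consists of the moduli of the entries of [d]; it is finite and, as [m]
    is positive, nonempty, so the supremum is attained. *)
Lemma spectral_radius_max (P : 'M[R[i]]_m) (d : 'rV[R]_m) :
    P \is unitarymx -> toC A = P^t* *m diag_mx (toC d) *m P ->
  (forall i, `|d 0 i| <= spectral_radius A) /\
  exists i, spectral_radius A = `|d 0 i|.
Proof.
move=> uP eA; rewrite /spectral_radius.
set S : set R := [set r : R | _]%classic.
have Sd r : S r <-> exists i, r = `|d 0 i|.
  have nd i : complex.Re `|(d 0 i)%:C| = `|d 0 i|.
    by rewrite normc_def /= expr0n addr0 sqrtr_sqr.
  split=> [[z /(eigenvalue_spectral _ uP eA) [i ->] ->]|[i ->]].
    by exists i.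
  by exists (d 0 i)%:C => //; apply/(eigenvalue_spectral _ uP eA); exists i.
pose i0 : 'I_m := Ordinal m_gt0.
case: (arg_maxP (fun i => `|d 0 i|) (erefl true : xpredT i0)) => k _ kmax.
have ubS : ubound S `|d 0 k| by move=> r /Sd [i ->]; apply: kmax.
have Sk : S `|d 0 k| by apply/Sd; exists k.
have -> : sup S = `|d 0 k|.
  apply/eqP; rewrite eq_le ge_sup //=; last by exists `|d 0 k|.
  by apply: ub_le_sup => //; exists `|d 0 k|.
by split=> [i|]; [apply: kmax | exists k].
Qed.

Lemma rayleigh_le (x : 'rV[R]_m) :
  (x *m A *m x^T) 0 0 <= spectral_radius A * (x *m x^T) 0 0.
Proof.
have [P [d [uP eA]]] := symmetric_spectral.
have [dle _] := spectral_radius_max uP eA.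
have := spectral_quadratic x uP eA (spectral_radius A).
rewrite !mxE => e; rewrite -subr_ge0 -ler0c e.
apply: sumr_ge0 => i _; rewrite mulr_ge0 ?exprn_ge0 // ler0c subr_ge0.
exact: le_trans (ler_norm _) (dle i).
Qed.

(** A sum of nonnegative terms vanishes, so each coordinate of [x] is zero or belongs to an
    eigenvalue equal to the spectral radius. *)
Lemma rayleigh_eq (x : 'rV[R]_m) :
    (x *m A *m x^T) 0 0 = spectral_radius A * (x *m x^T) 0 0 ->
  x *m A = spectral_radius A *: x.
Proof.
move=> xeq; have [P [d [uP eA]]] := symmetric_spectral.
have [dle _] := spectral_radius_max uP eA.
have := spectral_quadratic x uP eA (spectral_radius A).
have xP : toC x *m P^t* *m P = toC x by apply: (mulmxKtV (toC x) uP).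
move: (toC x *m P^t*) xP => y xP; rewrite [in X in X -> _]mxE [in X in X ->
  _]mxE.
rewrite [X in _ + X]mxE xeq subrr => /esym/eqP.
rewrite psumr_eq0 => [/allP y0|i _]; last first.
  rewrite mulr_ge0 ?exprn_ge0 // ler0c subr_ge0.
  exact: le_trans (ler_norm _) (dle i).
suff : toC (x *m A) = toC (spectral_radius A *: x).
  by move/matrixP=> e; apply/matrixP => i j; have := e i j;
    rewrite !mxE => /complexI.
rewrite map_mxM map_mxZ /= eA !mulmxA -xP !(mulmxtVK _ uP) scalemxAl.
congr (_ *m _); apply/rowP => i; rewrite mul_mx_diag !mxE.
have := y0 i (mem_index_enum _); rewrite mulf_eq0 expf_eq0 /= normr_eq0.
case/orP => [|/eqP ->]; last by rewrite mul0r mulr0.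
by rewrite rmorphB /= subr_eq0 => /eqP ->; rewrite mulrC.
Qed.

(** Let [v] be an eigenvector whose eigenvalue has maximal modulus, and [x] the row of moduli of its
    entries. The triangle inequality makes the Rayleigh quotient of [x] at least the spectral
    radius, so [rayleigh_eq] applies. *)
Lemma perron_nonneg : (forall i j, 0 <= A i j) ->
  exists x : 'rV[R]_m,
    [/\ x != 0, forall i, 0 <= x 0 i & x *m A = spectral_radius A *: x].
Proof.
move=> A0; have [P [d [uP eA]]] := symmetric_spectral.
have [_ [k rk]] := spectral_radius_max uP eA.
have : eigenvalue (toC A) (d 0 k)%:C.
  by apply/(eigenvalue_spectral _ uP eA); exists k.
case/eigenvalueP => v vA v0.
have [x xE] : exists x : 'rV[R]_m, forall i, (x 0 i)%:C = `|v 0 i|.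
  by exists (\row_i complex.Re `|v 0 i|) => i; rewrite mxE RRe_real ?normr_real.
have x_ge0 i : 0 <= x 0 i by rewrite -ler0c xE.
have x_neq0 : x != 0.
  apply: contra_neq v0 => x0; apply/rowP => i; apply/eqP.
  by rewrite mxE -normr_eq0 -xE x0 mxE.
exists x; split=> //; apply: rayleigh_eq; apply/eqP;
  rewrite eq_le rayleigh_le /=.
rewrite !mxE mulr_sumr; apply: ler_sum => i _; rewrite !mxE.
rewrite mulrA ler_wpM2r // -lecR; move/rowP/(_ i): vA; rewrite !mxE => vA.
have -> : (spectral_radius A * x 0 i)%:C = `|(d 0 k)%:C * v 0 i|.
  by rewrite normrM -xE normc_def /= expr0n addr0 sqrtr_sqr -rk -rmorphM.
rewrite -vA rmorph_sum /=; apply: (le_trans (ler_norm_sum _ _ _)).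
apply: ler_sum => j _; rewrite !mxE normrM rmorphM /= xE.
by rewrite [X in _ * X]ger0_norm ?ler0c.
Qed.

End SymmetricMatrix.

(** * Perron vectors of weighted graphs *)

Section WeightedGraph.
Variables (R : realType) (f : R -> R -> R).
Hypothesis f_sym : symmetric_ge1 f.
Hypothesis f_gt0 : forall x y, 1 <= x -> 1 <= y -> 0 < f x y.

(** The entries of [weighted_adj] indexed by vertices, so that graphs on the same vertices compare
    without enumerations. *)
Definition weight (G : sgraph) (x y : G) : R :=
  if adj x y then f (deg x)%:R (deg y)%:R else 0.

Lemma deg_ge1 (G : sgraph) (x y : G) : adj x y -> 1 <= (deg x)%:R :> R.
Proof.
by move=> xy; rewrite ler1n card_gt0; apply/set0Pn; exists y; rewrite inE.
Qed.

Lemma weightC (G : sgraph) (x y : G) : weight x y = weight y x.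
Proof.
rewrite /weight adj_sym; case: ifP => // yx.
by rewrite f_sym //; [apply: (deg_ge1 (y := y));
  rewrite adj_sym | apply: deg_ge1 yx].
Qed.

Lemma weight_gt0 (G : sgraph) (x y : G) : adj x y -> 0 < weight x y.
Proof.
move=> xy; rewrite /weight xy f_gt0 //; first exact: deg_ge1 xy.
by apply: (deg_ge1 (y := x)); rewrite adj_sym.
Qed.

Lemma weight_ge0 (G : sgraph) (x y : G) : 0 <= weight x y.
Proof.
by case: (boolP (adj x y)) => xy;
  [rewrite ltW ?weight_gt0 | rewrite /weight (negbTE xy)].
Qed.

Definition quad (G : sgraph) (x : G -> R) : R :=
  \sum_i \sum_j weight i j * (x i * x j).

Section Rayleigh.
Variable G : sgraph.

Local Notation row_of x := (\row_(i < #|{: G}|) x (enum_val i)).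

Lemma sum_enum_val (F : G -> R) :
  \sum_(i < #|{: G}|) F (enum_val i) = \sum_i F i.
Proof. by rewrite -(big_enum_val F). Qed.

Lemma weighted_adj_sym : (weighted_adj f G)^T = weighted_adj f G.
Proof. by apply/matrixP => i j; rewrite !mxE; apply: weightC. Qed.

Lemma row_weighted_adj (x : G -> R) i :
  (row_of x *m weighted_adj f G) 0 (enum_rank i) = \sum_j weight i j * x j.
Proof.
rewrite mxE -(sum_enum_val (fun j => weight i j * x j)); apply: eq_bigr => j _.
rewrite !mxE enum_rankK mulrC; congr (_ * _); exact: weightC.
Qed.

Lemma quadE (x : G -> R) :
  (row_of x *m weighted_adj f G *m (row_of x)^T) 0 0 = quad x.
Proof.
rewrite mxE /quad -(sum_enum_val (fun i => \sum_j weight i j * (x i * x j))).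
apply: eq_bigr => i _; rewrite -[i in LHS]enum_valK row_weighted_adj !mxE.
by rewrite enum_valK mulr_suml; apply: eq_bigr => j _; ring.
Qed.

Lemma sqnormE (x : G -> R) :
  (row_of x *m (row_of x)^T) 0 0 = \sum_i x i ^+ 2.
Proof.
rewrite mxE -(sum_enum_val (fun i => x i ^+ 2)).
by apply: eq_bigr => i _; rewrite !mxE expr2.
Qed.

Hypothesis G_gt0 : (0 < #|{: G}|)%N.

Lemma quad_le_rho (x : G -> R) : quad x <= rho f G * \sum_i x i ^+ 2.
Proof. by rewrite -quadE -sqnormE; apply: rayleigh_le weighted_adj_sym _ _. Qed.

Lemma quad_eq_rho (x : G -> R) : quad x = rho f G * \sum_i x i ^+ 2 ->
  forall i, \sum_j weight i j * x j = rho f G * x i.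
Proof.
rewrite -quadE -sqnormE => /(rayleigh_eq weighted_adj_sym G_gt0) e i.
by rewrite -row_weighted_adj e !mxE enum_rankK.
Qed.

Lemma perron_nonneg_graph : exists x : G -> R,
  [/\ exists i, x i != 0, forall i, 0 <= x i &
      forall i, \sum_j weight i j * x j = rho f G * x i].
Proof.
have [|x [x0 x_ge0 xA]] := perron_nonneg weighted_adj_sym G_gt0.
  by move=> i j; rewrite mxE weight_ge0.
exists (fun i => x 0 (enum_rank i)).
have xE : row_of (fun i => x 0 (enum_rank i)) = x.
  by apply/rowP => i; rewrite !mxE enum_valK.
split=> [|//|i]; last by rewrite -row_weighted_adj xE xA mxE.
apply/existsP; apply: contraNT x0; rewrite negb_exists => /forallP x0.
apply/eqP/rowP => i; rewrite mxE -(enum_valK i); exact/eqP/negbNE/x0.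
Qed.

Lemma quad_perron (x : G -> R) :
    (forall i, \sum_j weight i j * x j = rho f G * x i) ->
  quad x = rho f G * \sum_i x i ^+ 2.
Proof.
move=> xA; rewrite mulr_sumr; apply: eq_bigr => i _.
rewrite expr2 mulrA -xA mulr_suml; apply: eq_bigr => j _; ring.
Qed.

(** If a nonnegative eigenvector vanishes at [b], the row of [b] is a zero sum of nonnegative terms,
    so it vanishes at all neighbours of [b]. By connectedness it would vanish everywhere. *)
Lemma perron_connected : gconnected G -> exists x : G -> R,
  (forall i, 0 < x i) /\ forall i, \sum_j weight i j * x j = rho f G * x i.
Proof.
move=> /forallP G_conn; have [x [[i xi] x_ge0 xA]] := perron_nonneg_graph.
exists x; split=> // j; rewrite lt0r x_ge0 andbT.
have pos_closed : fingraph.closed (@adj G) [pred k | x k != 0].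
  apply: intro_closed => [|a b ab]; first exact/sym_connect_sym/adj_sym.
  rewrite !inE; apply: contra_neq => xb0.
  have /eqP := xA b; rewrite xb0 mulr0 psumr_eq0 => [|k _]; last first.
    by rewrite mulr_ge0 ?weight_ge0.
  move/allP/(_ a (mem_index_enum _)); rewrite mulf_eq0 gt_eqF ?weight_gt0 //=.
    by move/eqP.
  by rewrite adj_sym.
by have := closed_connect pos_closed (forallP (G_conn i) j); rewrite !inE xi.
Qed.

End Rayleigh.

(** A Perron vector of [G], transported along the isomorphism, is a test vector for [H] with the
    same Rayleigh quotient. *)
Lemma rho_iso_le (G H : sgraph) : (0 < #|{: G}|)%N ->
  iso G H -> rho f G <= rho f H.
Proof.
move=> G_gt0 [g [g' gK g'K] g_adj].
have [x [[i xi] x_ge0 xA]] := perron_nonneg_graph G_gt0.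
have bij_g : {on [pred _ | true], bijective g} by exists g' => ? _.
have bij_g' : {on [pred _ | true], bijective g'} by exists g => ? _.
have H_gt0 : (0 < #|{: H}|)%N by apply/card_gt0P; exists (g i).
have deg_g a : deg (g a) = deg a.
  rewrite /deg -(card_imset _ (can_inj gK)); apply: eq_card => b.
  rewrite !inE -[b]g'K g_adj g'K; apply/idP/imsetP => [ab|[c]].
    by exists (g' b); rewrite ?g'K ?inE.
  by rewrite inE => ac ->; rewrite gK.
have wg a b : weight (g a) (g b) = weight a b by rewrite /weight g_adj !deg_g.
have quad_g : quad (x \o g') = quad x.
  rewrite /quad (reindex g) //; apply: eq_bigr => a _.
  rewrite (reindex g) //; apply: eq_bigr => b _; by rewrite wg /= !gK.
have norm_g : \sum_j (x \o g') j ^+ 2 = \sum_j x j ^+ 2.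
  by rewrite (reindex g) //; apply: eq_bigr => a _ /=; rewrite gK.
have := quad_le_rho H_gt0 (x \o g').
rewrite quad_g norm_g (quad_perron xA) ler_pM2r //.
rewrite lt0r sumr_ge0 ?andbT => [|j _]; last exact: sqr_ge0.
rewrite psumr_eq0 => [|j _]; last exact: sqr_ge0.
by apply/allPn; exists i; rewrite ?mem_index_enum //= expf_eq0.
Qed.

Lemma iso_sym (G H : sgraph) : iso G H -> iso H G.
Proof.
move=> [g [g' gK g'K] g_adj]; exists g'; first by exists g.
by move=> a b; rewrite -g_adj !g'K.
Qed.

Lemma rho_iso (G H : sgraph) : (0 < #|{: G}|)%N ->
  iso G H -> rho f G = rho f H.
Proof.
move=> G_gt0 GH; apply/eqP; rewrite eq_le rho_iso_le //=.
apply: rho_iso_le (iso_sym GH); case: GH => g _ _.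
by case/card_gt0P: G_gt0 => i _; apply/card_gt0P; exists (g i).
Qed.

(* If the two radii agreed, then x would maximise both Rayleigh quotients,
   so it would be an eigenvector on both sides for the same eigenvalue. *)
Lemma rho_lt (G : sgraph) (r : rel G) rs ri (H := @SGraph G r rs ri)
    (x : G -> R) (u : G) :
    (forall i, \sum_j weight (i : G) j * x j = rho f G * x i) ->
    (forall i, 0 < x i) -> quad (x : G -> R) <= quad (x : H -> R) ->
    \sum_j weight (u : G) j * x j < \sum_j weight (u : H) j * x j ->
  rho f G < rho f H.
Proof.
move=> xG x_gt0 le_quad lt_u.
have V_gt0 : (0 < #|{: G}|)%N by apply/card_gt0P; exists u.
have n_gt0 : 0 < \sum_i x i ^+ 2.
  rewrite (bigD1 u) //= ltr_pwDl ?exprn_gt0 //.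
  by apply: sumr_ge0 => i _; apply: sqr_ge0.
have eG := quad_perron (G := G) xG.
have le_rho : rho f G <= rho f H.
  have := le_trans le_quad (quad_le_rho (G := H) V_gt0 x).
  by rewrite eG ler_pM2r.
rewrite lt_neqAle le_rho andbT; apply: contraTneq lt_u => eq_rho.
suff /quad_eq_rho-> : quad (x : H -> R) = rho f H * \sum_i x i ^+ 2.
- by rewrite xG eq_rho ltxx.
- exact: V_gt0.
apply/le_anti/andP; split; first exact: (quad_le_rho (G := H) V_gt0 x).
by move: le_quad; rewrite eG eq_rho.
Qed.

End WeightedGraph.

(** * Property P* *)

Section OneSidedCalculus.
Local Open Scope classical_set_scope.
Variable R : realType.

(* Continuing g below 1 by its tangent makes the one-sided derivative at 1
   two-sided, so that the usual mean value theorem applies. *)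
Definition tangent_ext (g : R -> R) (l : R) (t : R) : R :=
  if 1 <= t then g t else g 1 + l * (t - 1).

Lemma is_derive_tangent_ext (g g' : R -> R) :
    (forall x, 1 <= x -> has_derive_ge1 g x (g' x)) ->
  forall x : R, 1 <= x -> is_derive x 1 (tangent_ext g (g' 1)) (g' x).
Proof.
move=> dg x x_ge1; set e := tangent_ext _ _.
have cg : h^-1 *: ((e \o shift x) (h *: 1) - e x) @[h --> 0^'] --> g' x.
  move=> U Ul; have := dg x x_ge1 U Ul; rewrite !nbhs_filterE /= => gU.
  (* At an interior point, small increments stay inside the domain. *)
  have x_gt1 : \forall h \near 0^', 1 < x -> 1 < x + h.
    case: (ltP 1 x) => x1; last exact: nearW.
    near=> h => _; have : `|h| < x - 1.
      by near: h; apply: dnbhs0_lt; rewrite subr_gt0.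
    by rewrite ltr_norml => /andP[+ _]; lra.
  near=> h; rewrite /= scaler1 [h + x]addrC /e /tangent_ext x_ge1.
  case: ifPn => [xh|]; first by move: xh; near: h; exact: gU.
  (* Leaving the domain is possible only from [x = 1], and there the difference quotient of the
     tangent is exactly [g' 1]. *)
  rewrite -ltNge => xh; have x1 : x = 1.
    apply/eqP; rewrite eq_le x_ge1 andbT leNgt; apply/negP => x1.
    suff : 1 < x + h by rewrite ltNge ltW.
    by move: x1; near: h; exact: x_gt1.
  have h0 : h != 0 by near: h; exact: nbhs_dnbhs_neq.
  rewrite x1; have -> : g 1 + g' 1 * (1 + h - 1) - g 1 = h * g' 1 by ring.
  rewrite scalerA mulVf // scale1r -[in X in U X]x1; exact: nbhs_singleton.
by apply: DeriveDef; [apply: cvgP cg | apply: cvg_lim cg].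
Unshelve. all: by end_near.
Qed.

Lemma MVT_ge1 (g g' : R -> R) :
    (forall x, 1 <= x -> has_derive_ge1 g x (g' x)) ->
  forall a b, 1 <= a -> a <= b ->
  exists2 c, a <= c <= b & g b - g a = g' c * (b - a).
Proof.
move=> dg a b a1 ab; have de := is_derive_tangent_ext dg.
have [||c cab] := @MVT_segment R (tangent_ext g (g' 1)) g' a b ab.
- by move=> x; rewrite in_itv /= => /andP[ax _]; apply: de;
  apply: le_trans (ltW ax).
- apply: derivable_within_continuous => x; rewrite in_itv /= => /andP[ax _].
  by have := de x (le_trans a1 ax) => -[].
rewrite /tangent_ext a1 (le_trans a1 ab) => e.
by exists c.
Qed.

Lemma nondecreasing_ge1 (g g' : R -> R) :
    (forall x, 1 <= x -> has_derive_ge1 g x (g' x)) ->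
    (forall x, 1 <= x -> 0 <= g' x) ->
  forall a b, 1 <= a -> a <= b -> g a <= g b.
Proof.
move=> dg g'0 a b a1 ab; have [c /andP[ac _] e] := MVT_ge1 dg a1 ab.
by rewrite -subr_ge0 e mulr_ge0 ?subr_ge0 // g'0 // (le_trans a1).
Qed.

Lemma convex_increments_ge1 (g g' g'' : R -> R) :
    (forall x, 1 <= x -> has_derive_ge1 g x (g' x)) ->
    (forall x, 1 <= x -> has_derive_ge1 g' x (g'' x)) ->
    (forall x, 1 <= x -> 0 <= g'' x) ->
  forall a b h, 1 <= a -> a <= b -> 0 <= h -> g (a + h) - g a <= g (b + h) - g
    b.
Proof.
move=> dg dg' g''0 a b h a1 ab h0.
have slope p q p' q' : 1 <= p -> p <= q -> q <= p' -> p' <= q' ->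
    q - p = q' - p' -> g q - g p <= g q' - g p'.
  move=> p1 pq qp' pq' e.
  have p'1 : 1 <= p' by rewrite (le_trans p1) // (le_trans pq).
  have [c /andP[pc cq] ->] := MVT_ge1 dg p1 pq.
  have [c' /andP[pc' _] ->] := MVT_ge1 dg p'1 pq'.
  rewrite e ler_wpM2r ?subr_ge0 //; apply: nondecreasing_ge1 dg' g''0 _ _ _ _.
    exact: le_trans pc.
  by rewrite (le_trans cq) // (le_trans qp').
have [ahb|bah] := leP (a + h) b; first by apply: slope => //; lra.
(* The two intervals overlap. Exchanging the roles of [h] and [b - a] gives non-overlapping ones,
   and the same inequality after rearrangement. *)
have := slope a b (a + h) (b + h); lra.
Qed.

End OneSidedCalculus.

Section Pstar.
Variables (R : realType) (f : R -> R -> R).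
Hypothesis f_Pstar : property_Pstar f.

Lemma Pstar_monotone x x' y : 1 <= y -> 1 <= x -> x <= x' -> f x y <= f x' y.
Proof.
move=> y1; have [_ [fx [fxx fP]] _] := f_Pstar.
apply: (@nondecreasing_ge1 _ (f ^~ y) (fx ^~ y)) => t t1.
  by have [] := fP t y t1 y1.
by have [] := fP t y t1 y1.
Qed.

Lemma Pstar_increments a b h y : 1 <= y -> 1 <= a -> a <= b -> 0 <= h ->
  f (a + h) y - f a y <= f (b + h) y - f b y.
Proof.
move=> y1; have [_ [fx [fxx fP]] _] := f_Pstar.
by apply: (@convex_increments_ge1 _ (f ^~ y) (fx ^~ y) (fxx ^~ y)) => t t1;
  have [] := fP t y t1 y1.
Qed.

End Pstar.

(** * Comparison of spectral radii *)

(** The form is twice [D u v * (x u * x v)] plus twice the sum over the other [w] of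
    [x w * (D u w * x u + D v w * x v)]. It is meant for the change of the weight matrix under the
    Kelmans operation. *)
Lemma quad_form_two_rows_ge0 (R : realType) (V : finType) (D : V -> V -> R)
    (x : V -> R) (u v : V) : u != v -> (forall i, 0 <= x i) ->
    (forall i j, D i j = D j i) ->
    (forall i j, i != u -> i != v -> j != u -> j != v -> D i j = 0) ->
    D u u = 0 -> D v v = 0 -> 0 <= D u v ->
    (forall w, w != u -> w != v -> 0 <= D u w * x u + D v w * x v) ->
  0 <= \sum_i \sum_j D i j * (x i * x j).
Proof.
move=> uv x0 DC D0 Duu Dvv Duv Dw.
have vu : v != u by rewrite eq_sym.
have split_uv (F : V -> R) :
    \sum_i F i = F u + (F v + \sum_(i | (i != u) && (i != v)) F i).
  by rewrite (bigD1 u) //= (bigD1 v).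
have row i := split_uv (fun j => D i j * (x i * x j)).
rewrite split_uv !row Duu Dvv (DC v u).
have rest : 0 <= \sum_(i | (i != u) && (i != v)) \sum_j D i j * (x i * x j).
  apply: sumr_ge0 => i /andP[iu iv]; rewrite row big1 => [|j /andP[ju jv]].
    have := mulr_ge0 (x0 i) (Dw i iu iv); rewrite (DC i u) (DC i v); lra.
  by rewrite D0 // mul0r.
have rows : 0 <= \sum_(j | (j != u) && (j != v)) D u j * (x u * x j)
               + \sum_(j | (j != u) && (j != v)) D v j * (x v * x j).
  rewrite -big_split; apply: sumr_ge0 => j /andP[ju jv] /=.
  have := mulr_ge0 (x0 j) (Dw j ju jv); lra.
have := mulr_ge0 Duv (mulr_ge0 (x0 u) (x0 v)); lra.
Qed.

Section Comparisons.
Variables (R : realType) (f : R -> R -> R).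
Hypothesis f_sym : symmetric_ge1 f.
Hypothesis f_Pstar : property_Pstar f.

Let f_gt0 := Pstar_pos f_Pstar.

Lemma Pstar_monotone2 x x' y y' : 1 <= x -> 1 <= y -> x <= x' -> y <= y' ->
  f x y <= f x' y'.
Proof.
move=> x1 y1 xx' yy'; have x'1 := le_trans x1 xx'.
apply: (le_trans (Pstar_monotone f_Pstar y1 x1 xx')).
rewrite (f_sym x'1 y1) (f_sym x'1 (le_trans y1 yy')).
exact: Pstar_monotone.
Qed.

Lemma sum_weight_lt (G : sgraph) (r : rel G) rs ri (H := @SGraph G r rs ri)
    (x : G -> R) (u w : G) : (forall i, 0 < x i) ->
    (forall j, weight f (u : G) j <= weight f (u : H) j) ->
    weight f (u : G) w < weight f (u : H) w ->
  \sum_j weight f (u : G) j * x j < \sum_j weight f (u : H) j * x j.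
Proof.
move=> x_gt0 le_u lt_w; rewrite (bigD1 w) //= [ltRHS](bigD1 w) //=.
rewrite ltr_leD ?ltr_pM2r //; apply: ler_sum => j _.
by rewrite ler_pM2r.
Qed.

(** Degrees only grow, so by monotonicity no weight drops, and the entry at [x], [y] becomes
    positive. *)
Lemma rho_add_edge (G : sgraph) (x y : G) (xy : x != y) :
  gconnected G -> ~~ adj x y -> rho f G < rho f (add_edge xy).
Proof.
move=> conn nxy; have G_gt0 : (0 < #|{: G}|)%N by apply/card_gt0P; exists x.
have [z [z_gt0 zA]] := perron_connected f_sym f_gt0 G_gt0 conn.
have le_deg (a : G) : (deg a)%:R <= (@deg (add_edge xy) a)%:R :> R.
  rewrite ler_nat; apply: subset_leq_card; apply/fintype.subsetP => b.
  by rewrite !inE /= /add_rel => ->.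
have le_w (a b : G) : weight f a b <= @weight _ f (add_edge xy) a b.
  have [ab|nab] := boolP (adj a b); last first.
    by rewrite {1}/weight (negbTE nab) weight_ge0.
  rewrite /weight ab /= /add_rel ab /=; apply: Pstar_monotone2 => //.
    exact: deg_ge1 ab.
  by apply: (deg_ge1 _ (y := a)); rewrite adj_sym.
apply: (@rho_lt _ _ f_sym G _ (@add_sym G x y) (add_irr xy) z x) => //.
  apply: ler_sum => a _; apply: ler_sum => b _.
  by rewrite ler_wpM2r ?mulr_ge0 // ltW.
apply: (@sum_weight_lt G _ (@add_sym G x y) (add_irr xy) z x y) => //.
rewrite {1}/weight (negbTE nxy); apply: weight_gt0 => //.
by rewrite /= /add_rel !eqxx orbT.
Qed.

Lemma rho_kelmans (G : sgraph) (u v a b : G) (x : G -> R) :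
    (forall i, 0 < x i) -> (forall i, \sum_j weight f i j * x j = rho f G * x
      i) ->
    x v <= x u -> adj u v -> private u v a ->
    adj u b -> ~~ adj v b -> b != v ->
  rho f G < rho f (kelmans u v).
Proof.
move=> x_gt0 xA xvu uv a_priv ub nvb bv; set H := kelmans u v.
have vu : adj v u by rewrite adj_sym.
have u_neq_v := kelmans_neq uv.
pose p : R := #|private u v|%:R.
have p_gt0 : 0 < p by rewrite ltr0n; apply/card_gt0P; exists a.
have du : (@deg H u)%:R = (deg u)%:R + p by rewrite kelmans_deg_u // natrD.
have dv : (@deg H v)%:R + p = (deg v)%:R by rewrite -natrD kelmans_deg_v.
have dvu : (@deg H v)%:R < (deg u)%:R :> R by rewrite ltr_nat (kelmans_deg_lt
  uv ub).
have Huv : @adj H u v by rewrite /= kelmans_adju // uv.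
have Hvu : @adj H v u by rewrite adj_sym.
have du1 : 1 <= (deg u)%:R :> R by apply: deg_ge1 uv.
have dv1 : 1 <= (deg v)%:R :> R by apply: deg_ge1 vu.
have dv'1 : 1 <= (@deg H v)%:R :> R by apply: deg_ge1 Hvu.
have nbr_ge1 (w z : G) : adj w z -> 1 <= (deg z)%:R :> R.
  by rewrite adj_sym; apply: deg_ge1.
(* The two degrees keep their sum, and their difference grows in absolute value because [v] ends
   below the old degree of [u]: this is condition (ii). *)
have wuv : weight f u v <= @weight _ f H u v.
  rewrite /weight uv Huv; apply: (Pstar_spread f_Pstar) => //; rewrite ?du;
    try lra.
  rewrite [ltRHS]gtr0_norm ?ltr_norml ?du; last by lra.
  by apply/andP; split; lra.
have wu w : w != u -> w != v -> adj u w ->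
    weight f u w <= @weight _ f H u w.
  move=> wnu wnv uw;
    rewrite /weight uw /= kelmans_adju // uw (kelmans_deg uv wnu wnv) du.
  by apply: Pstar_monotone2 => //; [apply: nbr_ge1 uw | lra].
have le_row w : weight f u w <= @weight _ f H u w.
  have [->|wnu] := eqVneq w u; first by rewrite /weight !adj_irr.
  have [->|wnv] := eqVneq w v; first exact: wuv.
  have [uw|nuw] := boolP (adj u w); first exact: wu.
  by rewrite {1}/weight (negbTE nuw) weight_ge0.
have Hua : @adj H u a by rewrite /= kelmans_adju // a_priv orbT.
(* Strictness comes from row [u], where no weight drops and the entry at [a] becomes positive. It
   remains to compare the quadratic forms. *)
apply: (@rho_lt _ _ f_sym G _ (@kelmans_sym G u v) (@kelmans_irr G u v) x u) =>
  //;
  last first.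
  apply: (@sum_weight_lt G _ (@kelmans_sym G u v) (@kelmans_irr G u v) x u a)
    => //.
  have [_ nua _] := and3P a_priv.
  by rewrite {1}/weight (negbTE nua) (weight_gt0 f_gt0).
rewrite -subr_ge0 /quad -sumrB.
under eq_bigr do rewrite -sumrB.
under eq_bigr do under eq_bigr do rewrite -mulrBl.
apply: (@quad_form_two_rows_ge0 _ G (fun i j => @weight _ f H i j - weight f i
  j)
  x u v) => //.
- by move=> i; apply: ltW.
- by move=> i j; rewrite weightC // [X in _ - X]weightC.
- move=> i j iu iv ju jv; rewrite /weight /= kelmans_adj // (kelmans_deg uv iu
  iv) (kelmans_deg uv ju jv).
  by rewrite subrr.
- by rewrite /weight !adj_irr subrr.
- by rewrite /weight !adj_irr subrr.
- by rewrite subr_ge0.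
move=> w wnu wnv.
have [xu xv] : 0 <= x u /\ 0 <= x v by split; apply: ltW.
(* Outside the neighbourhood of [v], only row [u] can change, and it does not decrease. *)
have [vw|nvw] := boolP (adj v w); last first.
  have -> : @weight _ f H v w - weight f v w = 0.
    by rewrite /weight /= kelmans_adjv // (negbTE nvw) subrr.
  by rewrite mul0r addr0 mulr_ge0 ?subr_ge0.
have w1 : 1 <= (deg w)%:R :> R := nbr_ge1 _ _ vw.
(* For a private [w], the weight of [vw] passes to [uw], where both the degree and the Perron entry
   are at least as large. *)
have [w_priv|w_npriv] := boolP (private u v w).
  have [_ nuw _] := and3P w_priv.
  rewrite /weight /= kelmans_adju // kelmans_adjv // (negbTE nuw) vw w_priv /=.
  rewrite du (kelmans_deg uv wnu wnv) subr0 sub0r.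
  have f_le : f (deg v)%:R (deg w)%:R <= f ((deg u)%:R + p) (deg w)%:R.
    by apply: (Pstar_monotone f_Pstar) => //; lra.
  have := ltW (f_gt0 dv1 w1).
  by move=> f0; have := ler_pM f0 xv f_le xvu; lra.
have uw : adj u w.
  by move: w_npriv; rewrite /private vw wnu andbT /= negbK.
rewrite /weight /= kelmans_adju // kelmans_adjv // uw vw w_npriv /=.
rewrite du (kelmans_deg uv wnu wnv) -dv.
(* For a common neighbour, the degree of [u] rises and that of [v] falls by the same amount;
   convexity makes the gain at [u] at least the loss at [v]. *)
have incr := Pstar_increments f_Pstar w1 dv'1 (ltW dvu) (ltW p_gt0).
have mono : f (@deg H v)%:R (deg w)%:R <= f ((@deg H v)%:R + p) (deg w)%:R.
  by apply: (Pstar_monotone f_Pstar) => //; lra.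
have := ler_pM (_ : 0 <= f (_ + p) _ - f _ _) xv incr xvu.
by rewrite subr_ge0 => /(_ mono); lra.
Qed.

End Comparisons.

(** * Maximal graphs *)

Section GraphOfSet.
Variables (V : finType) (r : {set V * V}).

(** Sets of pairs code the graphs on [V] by a finite type, over which a maximum can be taken.
    Symmetrising and dropping the diagonal makes every set a valid code. *)
Definition pair_rel (x y : V) : bool :=
  (x != y) && (((x, y) \in r) || ((y, x) \in r)).

Lemma pair_sym : symmetric pair_rel.
Proof. by move=> x y; rewrite /pair_rel eq_sym orbC. Qed.

Lemma pair_irr : irreflexive pair_rel.
Proof. by move=> x; rewrite /pair_rel eqxx. Qed.

Definition graph_of : sgraph := SGraph pair_sym pair_irr.

End GraphOfSet.

(** An equality rather than an isomorphism, so that facts transfer by rewriting; it rests on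
    extensionality and proof irrelevance. *)
Lemma graph_of_adj (G : sgraph) :
  graph_of [set p : G * G | adj p.1 p.2]%SET = G.
Proof.
case: G => V a a_sym a_irr; rewrite /graph_of.
move: (pair_sym _) (pair_irr _); have -> : pair_rel [set p | a p.1 p.2]%SET = a.
  apply/funext => x; apply/funext => y;
    rewrite /pair_rel !inE /= orbC a_sym orbb.
  by have [->|] := eqVneq x y; rewrite ?a_irr.
by move=> s i; congr SGraph; apply: Prop_irrelevance.
Qed.

Lemma exists_subset_card (T : finType) (A : {set T}) n :
  (n <= #|A|)%N -> exists2 B : {set T}, B \subset A & #|B| = n.
Proof.
move=> nA; exists [set x in take n (enum A)]%SET.
  by apply/fintype.subsetP => x; rewrite inE => /mem_take; rewrite mem_enum.
rewrite cardsE; have /card_uniqP -> := take_uniq n (enum_uniq A).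
by rewrite size_takel // -cardE.
Qed.

(** * Existence and shape of graphs of maximal radius *)

Section Extremal.
Variables (R : realType) (f : R -> R -> R) (s : nat).
Hypothesis f_sym : symmetric_ge1 f.
Hypothesis f_Pstar : property_Pstar f.

Let f_gt0 := Pstar_pos f_Pstar.

(** At least [s] rather than exactly [s], since the Kelmans operation can create cut edges. *)
Definition admissible (G : sgraph) : bool :=
  gconnected G && (s <= #|cut_edges G|)%N.

(** Competitors share the vertex type of [G], as do the results of both graph operations. *)
Definition rho_maximal (G : sgraph) : Prop :=
  forall (a : rel G) a_sym a_irr, admissible (@SGraph G a a_sym a_irr) ->
    rho f (@SGraph G a a_sym a_irr) <= rho f G.

Lemma exists_rho_maximal (G : sgraph) : admissible G ->
  exists M : sgraph, [/\ #|{: M}| = #|{: G}|, admissible M, rho f G <= rho f M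
    & rho_maximal M].
Proof.
have GE := graph_of_adj G; move: [set p : G * G | _]%SET GE => r0 GE G_adm.
have r0_adm : admissible (graph_of r0) by rewrite GE.
have [r r_adm r_max] := @arg_maxP _ _ _ r0 (fun r => admissible (graph_of r))
  (fun r => rho f (graph_of r)) r0_adm.
exists (graph_of r); split; [exact: erefl | exact: r_adm | |].
  have r0_max : rho f (graph_of r0) <= rho f (graph_of r) := r_max _ r0_adm.
  by move: r0_max; rewrite GE.
move=> a a_sym a_irr H_adm; set H := SGraph _ _.
have HE := graph_of_adj H; move: [set p : G * G | _]%SET HE => r' HE.
have r'_adm : admissible (graph_of r') by rewrite HE.
have r'_max : rho f (graph_of r') <= rho f (graph_of r) := r_max _ r'_adm.
by move: r'_max; rewrite HE.
Qed.

Lemma rho_maximal_extremal (M : sgraph) : (0 < #|{: M}|)%N ->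
  admissible M -> rho_maximal M -> iso M (extremal_graph #|{: M}| s).
Proof.
move=> M_gt0 /andP[conn s_cut] M_max.
have [x [x_gt0 xA]] := perron_connected f_sym f_gt0 M_gt0 conn.
(* By maximality, adjacent vertices cannot both have private neighbours. *)
have no_kelmans u v a b : x v <= x u -> adj u v -> private u v a ->
    adj u b -> ~~ adj v b -> b != v -> False.
  move=> xvu uv a_priv ub nvb bv.
  have := rho_kelmans f_sym f_Pstar x_gt0 xA xvu uv a_priv ub nvb bv.
  rewrite ltNge M_max //; apply/andP; split; first exact: kelmans_connected.
  exact: leq_trans s_cut (kelmans_cut_edges uv conn).
have [|c c_univ] := exists_universal_vertex M_gt0 conn.
  move=> u v uv.
  have [/'forall_implyP vu_sub|] :=
    boolP [forall w, (adj v w && (w != u)) ==> adj u w].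
    by left=> w vw wu; apply: vu_sub; rewrite vw.
  case/forallPn => a; rewrite negb_imply => /andP[/andP[va au] nua].
  have [/'forall_implyP uv_sub|] :=
    boolP [forall w, (adj u w && (w != v)) ==> adj v w].
    by right=> w uw wv; apply: uv_sub; rewrite uw.
  case/forallPn => b; rewrite negb_imply => /andP[/andP[ub bv] nvb].
  (* The operation moves neighbours towards the end with the larger Perron entry. *)
  have [xvu|/ltW xuv] := leP (x v) (x u).
    by case: (no_kelmans u v a b); rewrite // /private va nua.
  case: (no_kelmans v u b a) => //; first by rewrite adj_sym.
  by rewrite /private ub nvb.
(* [T] consists of exactly [s] leaves; any further leaf counts among the vertices to be made a
   clique. *)
have [T TL cardT] := exists_subset_card (leq_trans s_cut (cut_edges_leaves
  c_univ conn)).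
rewrite -cardT; apply: (iso_extremal c_univ TL) => y z.
rewrite !inE !negb_or => /andP[_ yT] /andP[_ zT] yz; apply: contraT => nyz.
have := rho_add_edge f_sym f_Pstar yz conn nyz.
rewrite ltNge M_max //; apply/andP; split; first exact: add_edge_connected.
by rewrite -cardT; apply: (add_edge_cut c_univ yz TL).
Qed.

(** Some maximal graph of the same order dominates [G], and it is isomorphic to the extremal graph,
    so their radii agree. *)
Lemma rho_le_extremal (G : sgraph) : (0 < #|{: G}|)%N -> admissible G ->
  rho f G <= rho f (extremal_graph #|{: G}| s).
Proof.
move=> G_gt0 /exists_rho_maximal[M [cardM M_adm le_GM M_max]].
rewrite -cardM in G_gt0 *; apply: (le_trans le_GM).
by rewrite (rho_iso f_sym f_gt0 G_gt0 (rho_maximal_extremal G_gt0 M_adm M_max)).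
Qed.

End Extremal.

Theorem theorem2p6 (R : realType) (f : R -> R -> R)
    (f_sym : symmetric_ge1 f) (f_Pstar : property_Pstar f)
    (n s : nat) (n_ge1 : (1 <= n)%N)
    (G : sgraph) (GP : graph_class n s G) :
  rho f G <= rho f (extremal_graph n s) /\
  (rho f G = rho f (extremal_graph n s) <-> iso G (extremal_graph n s)).
Proof.
have [cardG conn cardC] := GP.
have G_gt0 : (0 < #|{: G}|)%N by rewrite cardG.
have G_adm : admissible s G by rewrite /admissible conn cardC leqnn.
rewrite -cardG; split; first exact: rho_le_extremal.
split=> [eqG|]; last exact: (rho_iso f_sym (Pstar_pos f_Pstar) G_gt0).
(* Equality makes [G] itself maximal, since every admissible graph on its vertices obeys the same
   bound. *)
apply: (rho_maximal_extremal f_sym f_Pstar G_gt0 G_adm) => a a_sym a_irr a_adm.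
rewrite [leRHS]eqG.
exact: (@rho_le_extremal R f s f_sym f_Pstar (SGraph a_sym a_irr) G_gt0 a_adm).
Qed.
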